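(* Let $\Omega\subseteq\mathbb{R}^n$ be open and let $u:\Omega\to\mathbb{R}^N$ be an immersion in $C^2(\Omega)^N$. Then the system $$Q_\infty u=\Big(K_P\otimes K_P+[K_P]^\perp K_{PP}\Big)(Du):D^2u=0$$ is equivalent on each phase $\Omega_k=\mathrm{int}\{\mathrm{rk}(S(Du^\top Du))=k\}$, $k=0,\dots,n$, to the pair of systems $$S(\mathbf{G})\,D\big(\mathrm{tr}(\mathbf{G})\big)=0,$$ $$\mathbb{B}^\perp:\big(\mathrm{tr}(\mathbf{G})\big)_P=0,$$ where $\mathbf{G}=g\,\det(g)^{-1/n}$ with $g=Du^\top Du$. Moreover, the first system $S(\mathbf{G})D(\mathrm{tr}(\mathbf{G}))=0$ is valid on all of $\Omega$ when $Q_\infty u=0$ on $\Omega$.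
   Context: Immersion: a $C^1$ map $u:\Omega\subseteq\mathbb{R}^n\to\mathbb{R}^N$ with $\mathrm{rk}(Du)=n$ everywhere. $Du=(D_iu_\alpha)$ is an $N\times n$ matrix. Repeated indices are summed. For $P\in\mathbb{R}^{N\times n}$, $|P|=\mathrm{tr}(P^\top P)^{1/2}$. Dilation function: $K(P)=|P|^2\det(P^\top P)^{-1/n}$ on $\{P\in\mathbb{R}^{N\times n}:\det(P^\top P)>0\}$; $K_P$, $K_{PP}$ are its first and second derivatives, with components $K_{P_{\alpha i}}$, $K_{P_{\alpha i}P_{\beta j}}$. Thus $\mathrm{tr}(\mathbf{G})=K(Du)$, and $(\mathrm{tr}(\mathbf{G}))_P$ denotes $K_P(Du)$. $[K_P(Du)]^\perp$ is, at each point, the orthogonal projection of $\mathbb{R}^N$ onto the nullspace of $K_P(Du)^\top:\mathbb{R}^N\to\mathbb{R}^n$. In index form $Q_\infty u=0$ reads $\big(K_{P_{\alpha i}}K_{P_{\beta j}}+[K_P]^\perp_{\alpha\gamma}K_{P_{\gamma i}P_{\beta j}}\big)(Du)\,D^2_{ij}u_\beta=0$ for all $\alpha$. Ahlfors operator: $S(A)=\frac12(A+A^\top)-\frac1n\mathrm{tr}(A)I$ for $A\in\mathbb{R}^{n\times n}$. Generalized second fundamental form: let $\mathcal{S}=\Omega\setminus\bigcup_{k=0}^n\Omega_k$. For every open $D\subseteq\Omega\setminus\mathcal{S}$ and every local normal section $\nu\in\Gamma([K_P(Du)]^\perp,D)$, i.e. every $C^1$ map $\nu:D\to\mathbb{R}^N$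 with $\nu^\top K_P(Du)=0$ on $D$, set $(\mathbb{B}^\perp)_\nu:=D\nu$. The equation $\mathbb{B}^\perp:(\mathrm{tr}(\mathbf{G}))_P=0$ on $\Omega_k$ means that $D\nu:K_P(Du)=D_i\nu_\alpha K_{P_{\alpha i}}(Du)=0$ on $D$ for every open $D\subseteq\Omega_k$ and every such $\nu$. *)

(* Defs.v *)
From HB Require Import structures.
From mathcomp Require Import all_boot all_order all_algebra.
From mathcomp Require Import all_classical all_reals all_analysis.

Set Implicit Arguments.
Unset Strict Implicit.
Unset Printing Implicit Defensive.

Import Order.TTheory GRing.Theory Num.Theory.
Import numFieldNormedType.Exports.

Local Open Scope classical_set_scope.
Local Open Scope ring_scope.

(* Points of R^n and values in R^N are row vectors. Maps are total functions;
   only their values on the open set A under consideration matter, since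
   derivatives and continuity at a point of A depend only on the germ. *)

Definition C1_on (R : realType) (V W : normedModType R) (A : set V)
    (f : V -> W) : Prop :=
  forall x, A x ->
    differentiable f x /\ forall v, {for x, continuous (fun y => 'D_v f y)}.

Definition C2_on (R : realType) (V W : normedModType R) (A : set V)
    (f : V -> W) : Prop :=
  C1_on A f /\ forall v, C1_on A (fun y => 'D_v f y).

(* The library's Jacobian acts on row vectors, hence the transpose: the
   (alpha, i) entry of Du is D_i u_alpha. *)
Definition Du (R : realType) (n N : nat) (u : 'rV[R]_n -> 'rV[R]_N)
    (x : 'rV[R]_n) : 'M[R]_(N, n) := ('J u x)^T.

Definition immersion (R : realType) (n N : nat) (Omega : set 'rV[R]_n)
    (u : 'rV[R]_n -> 'rV[R]_N) : Prop :=
  C1_on Omega u /\ forall x, Omega x -> \rank (Du u x) = n.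

(* D_i D_j u_b *)
Definition D2 (R : realType) (n N : nat) (u : 'rV[R]_n -> 'rV[R]_N)
    (x : 'rV[R]_n) (i j : 'I_n) (b : 'I_N) : R :=
  'D_(delta_mx 0 i) (fun y => Du u y b j) x.

Definition gradient (R : realType) (n : nat) (f : 'rV[R]_n -> R)
    (x : 'rV[R]_n) : 'cV[R]_n := \col_i 'D_(delta_mx 0 i) f x.

Definition colon (R : realType) (m n : nat) (A B : 'M[R]_(m, n)) : R :=
  \sum_a \sum_i A a i * B a i.

Definition frob (R : realType) (N n : nat) (P : 'M[R]_(N, n)) : R :=
  Num.sqrt (\tr (P^T *m P)).

(* The dilation is of interest on the open set where \det (P^T *m P) > 0;
   elsewhere its value is a convention. *)
Definition K (R : realType) (N n : nat) (P : 'M[R]_(N, n)) : R :=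
  frob P ^+ 2 * (\det (P^T *m P)) `^ (- n%:R^-1).

Definition KP (R : realType) (N n : nat) (P : 'M[R]_(N, n)) : 'M[R]_(N, n) :=
  \matrix_(a, i) 'D_(delta_mx a i) (@K R N n) P.

Definition KPP (R : realType) (N n : nat) (P : 'M[R]_(N, n))
    (a : 'I_N) (i : 'I_n) (b : 'I_N) (j : 'I_n) : R :=
  'D_(delta_mx b j) (fun Q => KP Q a i) P.

(* kermx A is the space of rows xi with xi *m A = 0, i.e. the nullspace of A^T;
   kermx V^T is the orthogonal complement of the row space of V. proj_mx acts on
   row vectors, hence the outer transpose. *)
Definition perp (R : realType) (N n : nat) (A : 'M[R]_(N, n)) : 'M[R]_N :=
  let V := kermx A in (proj_mx V (kermx V^T))^T.

Definition Qinf (R : realType) (n N : nat) (u : 'rV[R]_n -> 'rV[R]_N)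
    (x : 'rV[R]_n) (a : 'I_N) : R :=
  let P := Du u x in
  \sum_i \sum_b \sum_j
    (KP P a i * KP P b j + \sum_c perp (KP P) a c * KPP P c i b j)
    * D2 u x i j b.

Definition Ahlfors (R : realType) (n : nat) (A : 'M[R]_n) : 'M[R]_n :=
  2^-1 *: (A + A^T) - (n%:R^-1 * \tr A)%:M.

Definition metric (R : realType) (n N : nat) (u : 'rV[R]_n -> 'rV[R]_N)
    (x : 'rV[R]_n) : 'M[R]_n := (Du u x)^T *m Du u x.

Definition G (R : realType) (n N : nat) (u : 'rV[R]_n -> 'rV[R]_N)
    (x : 'rV[R]_n) : 'M[R]_n :=
  (\det (metric u x)) `^ (- n%:R^-1) *: metric u x.

Definition phase (R : realType) (n N : nat) (Omega : set 'rV[R]_n)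
    (u : 'rV[R]_n -> 'rV[R]_N) (k : nat) : set 'rV[R]_n :=
  interior [set x | Omega x /\ \rank (Ahlfors (metric u x)) = k].

Definition normal_section (R : realType) (n N : nat)
    (u : 'rV[R]_n -> 'rV[R]_N) (D : set 'rV[R]_n)
    (nu : 'rV[R]_n -> 'rV[R]_N) : Prop :=
  C1_on D nu /\ forall x, D x -> nu x *m KP (Du u x) = 0.

Definition Bperp (R : realType) (n N : nat) (nu : 'rV[R]_n -> 'rV[R]_N)
    (x : 'rV[R]_n) : 'M[R]_(N, n) := Du nu x.

Definition Qinf_system (R : realType) (n N : nat) (A : set 'rV[R]_n)
    (u : 'rV[R]_n -> 'rV[R]_N) : Prop :=
  forall x, A x -> forall a, Qinf u x a = 0.

Definition tangential_system (R : realType) (n N : nat) (A : set 'rV[R]_n)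
    (u : 'rV[R]_n -> 'rV[R]_N) : Prop :=
  forall x, A x ->
    Ahlfors (G u x) *m gradient (fun y => \tr (G u y)) x = 0.

(* Bperp : (tr G)_P = 0 on A, where (tr G)_P stands for K_P(Du). *)
Definition normal_system (R : realType) (n N : nat) (A : set 'rV[R]_n)
    (u : 'rV[R]_n -> 'rV[R]_N) : Prop :=
  forall (D : set 'rV[R]_n), open D -> D `<=` A ->
  forall nu : 'rV[R]_n -> 'rV[R]_N, normal_section u D nu ->
  forall x, D x -> colon (Bperp nu x) (KP (Du u x)) = 0.

(* Main.v *)
Require Import Defs.
From HB Require Import structures.
From mathcomp Require Import all_boot all_order all_algebra.
From mathcomp Require Import all_classical all_reals all_analysis.
From mathcomp Require Import ring lra.
Import Order.TTheory GRing.Theory Num.Theory.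
Import numFieldNormedType.Exports.
Local Open Scope classical_set_scope.
Local Open Scope ring_scope.

Set Implicit Arguments.
Unset Strict Implicit.
Unset Printing Implicit Defensive.

(** Write [P = Du(x)], [g = P^T P] and [Gn = det(g)^(-1/n) g].

    By the chain rule, contracting [D^2 u] with [K_P] gives the gradient of
    [tr G = K(Du)], and contracting it with [K_PP] gives the row-wise divergence
    of the matrix field [K_P(Du)].  So [Q_infty u] at a point is
      [K_P D(tr G) + [K_P]^perp Div (K_P(Du))]   (lemma [Qinf_col]).
    The first term lies in the column space of [K_P] and the second one in its
    orthogonal complement, so [Q_infty u = 0] if and only if both vanish
    ([range_perp_sum_eq0]).

    First term.  Differentiating [K] with Jacobi's formula for the determinant
    gives [K_P = 2 P g^-1 S(Gn)] ([KP_formula]).  Since [P g^-1] is injective,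
    [K_P D(tr G) = 0] says exactly that [S(G) D(tr G) = 0] ([KP_mul_eq0]).  This
    argument is pointwise, hence valid on all of [Omega].

    Second term.  Differentiating [nu^T K_P(Du) = 0] for a normal section [nu]
    gives [D nu : K_P(Du) = - nu . Div (K_P(Du))] ([normal_section_Div]).  So the
    normal system says that [Div (K_P(Du))] is orthogonal to the values of all
    local normal sections, while the vanishing of the second term says that it
    is orthogonal to the whole nullspace of [K_P^T].  The two conditions agree
    when every null vector at a point extends to a local [C^1] normal section.
    This holds where [K_P(Du)] has constant rank ([kernel_section]), and the
    rank of [K_P(Du)] is that of [S(g)] ([rank_KP]), which is constant on each
    phase.  The positivity of [det g] needed for the formula for [K_P] is
    [det_gram_gt0]. *)

(** * Calculus of continuously differentiable maps *)

Section C1.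
Variables (R : realType) (V : normedModType R).
Implicit Types (A : set V) (x v : V).

(** The remainder in the first order expansion is a condition on germs; a
    function and its replacement share the same differential. *)
Lemma near_eq_differentiable (W : normedModType R) (f g : V -> W) x :
  (\near x, f x = g x) -> differentiable f x -> differentiable g x.
Proof.
move=> fg df; have fgx := nbhs_singleton fg.
have g_exp : g \o shift x = cst (g x) + 'd f x +o_ 0 id.
  apply/eqaddoP => e e0; have := diff_locally df.
  move=> /eqaddoP/(_ e e0).
  have fg0 : \forall y \near 0, f (y + x) = g (y + x).
    by move: fg; rewrite (near_shift 0 x) subr0.
  apply: filterS2 fg0 => y; rewrite !fctE /= => ->; by rewrite fgx.
have cdf : continuous ('d f x) by exact: diff_continuous.
by apply/diff_locallyP; rewrite (diff_unique cdf g_exp).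
Qed.

Lemma C1_on_eq (W : normedModType R) A (f g : V -> W) :
  open A -> (forall x, A x -> f x = g x) -> C1_on A f -> C1_on A g.
Proof.
move=> oA fg C1f x Ax; have [df cf] := C1f x Ax.
have fgn y : A y -> \near y, f y = g y.
  by move=> Ay; near do apply: fg; exact: open_nbhs_nbhs.
split=> [|v]; first exact: near_eq_differentiable (fgn x Ax) df.
rewrite /prop_for /continuous_at -(near_eq_derive v (fgn x Ax)).
apply: cvg_trans (cf v); apply: near_eq_cvg.
near=> y; apply: near_eq_derive; apply: fgn.
by near: y; exact: open_nbhs_nbhs.
Unshelve. all: by end_near. Qed.

Lemma C1_on_sub (W : normedModType R) A B (f : V -> W) :
  A `<=` B -> C1_on B f -> C1_on A f.
Proof. by move=> AB C1f x /AB/C1f. Qed.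

(** Continuity at a point of the derivative concerns its values nearby, so it
    can be checked on any expression [df] that computes it on an open set. *)
Lemma C1_onI (W : normedModType R) A (f : V -> W) (df : V -> V -> W) :
  open A -> (forall x, A x -> differentiable f x) ->
  (forall x v, A x -> 'D_v f x = df v x) ->
  (forall x v, A x -> {for x, continuous (df v)}) -> C1_on A f.
Proof.
move=> oA dif dfE cdf x Ax; split=> [|v]; first exact: dif.
rewrite /prop_for /continuous_at dfE//; apply: cvg_trans (cdf x v Ax).
apply: near_eq_cvg; near=> y; apply/esym/dfE.
by near: y; exact: open_nbhs_nbhs.
Unshelve. all: by end_near. Qed.

Lemma C1_on_cst (W : normedModType R) A (c : W) : C1_on A (fun=> c).
Proof.
move=> x _; split=> [|v]; first exact: differentiable_cst.
have -> : 'D_v (cst c : V -> W) = cst 0 by apply/funext => y; exact: derive_cst.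
exact: cst_continuous.
Qed.

Lemma C1_on_continuous (W : normedModType R) A (f : V -> W) x :
  C1_on A f -> A x -> {for x, continuous f}.
Proof. by move=> C1f /C1f[df _]; exact: differentiable_continuous. Qed.

Lemma C1_onD (W : normedModType R) A (f g : V -> W) : open A ->
  C1_on A f -> C1_on A g -> C1_on A (fun x => f x + g x).
Proof.
move=> oA C1f C1g.
apply: (@C1_onI _ _ _ (fun v x => 'D_v f x + 'D_v g x)) => // [x|x v|x v] Ax;
  have [df cf] := C1f x Ax; have [dg cg] := C1g x Ax.
- exact: differentiableD.
- by apply: deriveD; exact: diff_derivable.
- by apply: cvgD; [exact: cf|exact: cg].
Qed.

Lemma C1_onM A (f g : V -> R) : open A ->
  C1_on A f -> C1_on A g -> C1_on A (fun x => f x * g x).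
Proof.
move=> oA C1f C1g.
apply: (@C1_onI _ _ _ (fun v x => f x * 'D_v g x + g x * 'D_v f x))
  => // [x|x v|x v] Ax; have [df cf] := C1f x Ax; have [dg cg] := C1g x Ax.
- exact: differentiableM.
- by apply: deriveM; exact: diff_derivable.
- have cfx := differentiable_continuous df.
  have cgx := differentiable_continuous dg.
  by apply: cvgD; [exact: (cvgM cfx (cg v))|exact: (cvgM cgx (cf v))].
Qed.

Lemma C1_onMl A (c : R) (f : V -> R) : open A ->
  C1_on A f -> C1_on A (fun x => c * f x).
Proof. by move=> oA C1f; apply: (C1_onM oA _ C1f); exact: C1_on_cst. Qed.

Lemma C1_on_sum (W : normedModType R) A I (s : seq I) (F : I -> V -> W) :
  open A ->
  (forall i, C1_on A (F i)) -> C1_on A (fun x => \sum_(i <- s) F i x).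
Proof.
move=> oA C1F; elim: s => [|i s IHs].
  by under eq_fun do rewrite big_nil; exact: C1_on_cst.
under eq_fun do rewrite big_cons.
exact: (C1_onD oA (C1F i) IHs).
Qed.

Lemma C1_on_prod A I (s : seq I) (F : I -> V -> R) : open A ->
  (forall i, C1_on A (F i)) -> C1_on A (fun x => \prod_(i <- s) F i x).
Proof.
move=> oA C1F; elim: s => [|i s IHs].
  by under eq_fun do rewrite big_nil; exact: C1_on_cst.
under eq_fun do rewrite big_cons.
exact: (C1_onM oA (C1F i) IHs).
Qed.

Lemma derive_comp1 (f : V -> R) (h : R -> R) x v (dh : R) :
  differentiable f x -> is_derive (f x) 1 h dh ->
  differentiable (fun y => h (f y)) x /\
  'D_v (fun y => h (f y)) x = dh * 'D_v f x.
Proof.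
move=> df dhx; have difh : differentiable h (f x) by exact/derivable1_diffP.
have difc : differentiable (h \o f) x by exact: differentiable_comp.
split=> //; rewrite -[fun y => _]/(h \o f) (deriveE _ difc) diff_comp//=.
by rewrite diff1E// derive1E derive_val -deriveE// mulrC.
Qed.

Lemma C1_on_comp1 A (f : V -> R) (h h' : R -> R) : open A -> C1_on A f ->
  (forall x, A x -> is_derive (f x) 1 h (h' (f x))) ->
  (forall x, A x -> {for f x, continuous h'}) ->
  C1_on A (fun x => h (f x)).
Proof.
move=> oA C1f dh ch.
apply: (@C1_onI _ _ _ (fun v x => h' (f x) * 'D_v f x)) => // [x|x v|x v] Ax;
  have [df cf] := C1f x Ax.
- by have [] := derive_comp1 0 df (dh x Ax).
- by have [] := derive_comp1 v df (dh x Ax).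
- have cfx := differentiable_continuous df.
  exact: (cvgM (continuous_comp cfx (ch x Ax)) (cf v)).
Qed.

Lemma C1_on_inv A (f : V -> R) : open A -> C1_on A f ->
  (forall x, A x -> f x != 0) -> C1_on A (fun x => (f x)^-1).
Proof.
move=> oA C1f f0; apply: (@C1_on_comp1 _ _ GRing.inv (fun y => - y ^- 2)) => //.
- move=> x /f0 fx0.
  apply: DeriveDef; first exact: (@derivableV _ _ id).
  by rewrite (@deriveV _ _ id)// derive_id /GRing.scale/= mulr1.
- move=> x /f0 fx0; apply: cvgN; apply: cvgV; first by rewrite expf_neq0.
  exact: exprn_continuous.
Qed.

Lemma C1_on_powR A (f : V -> R) (p : R) : open A -> C1_on A f ->
  (forall x, A x -> 0 < f x) -> C1_on A (fun x => f x `^ p).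
Proof.
move=> oA C1f f0.
apply: (@C1_on_comp1 _ _ (fun y => y `^ p) (fun y => p * y `^ (p - 1))) => //.
- by move=> x /f0 fx0; exact: is_derive1_powR.
- move=> x /f0 fx0.
  have /derivable1_diffP/differentiable_continuous cpow :
      derivable (fun y : R => y `^ (p - 1)) (f x) 1.
    by apply: derivable_powR; rewrite in_itv/= fx0.
  exact: (cvgM (cvg_cst p) cpow).
Qed.

Lemma derive_coord m n (f : V -> 'M[R]_(m, n)) x v i j :
  differentiable f x -> 'D_v (fun y => f y i j) x = 'D_v f x i j.
Proof. by move=> /diff_derivable df; rewrite derive_mx// mxE. Qed.

Lemma C1_on_coord A m n (f : V -> 'M[R]_(m, n)) i j : open A ->
  C1_on A f -> C1_on A (fun x => f x i j).
Proof.
move=> oA C1f; apply: (@C1_onI _ _ _ (fun v x => 'D_v f x i j))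
  => // [x|x v|x v] Ax; have [df cf] := C1f x Ax.
- exact: (differentiable_comp df (differentiable_coord _ i j)).
- exact: derive_coord.
- exact: (continuous_comp (cf v) (@coord_continuous _ _ _ i j _)).
Qed.

Lemma C1_on_scalel (W : normedModType R) A (a : V -> R) (w : W) : open A ->
  C1_on A a -> C1_on A (fun x => a x *: w).
Proof.
move=> oA C1a.
apply: (@C1_onI _ _ _ (fun v x => 'D_v a x *: w)) => // [x|x v|x v] Ax;
  have [da ca] := C1a x Ax.
- exact: differentiableZl.
- have dZ := @differentiableZl _ _ _ _ w _ da.
  by rewrite (deriveE _ dZ) diffZl// -deriveE.
- by apply: cvgZr_tmp; exact: ca.
Qed.

(** A matrix-valued map is a finite sum of scalar functions times constant
    matrices, which reduces its regularity to that of its entries. *)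
Lemma C1_on_mx A m n (f : V -> 'M[R]_(m, n)) : open A ->
  (forall i j, C1_on A (fun x => f x i j)) -> C1_on A f.
Proof.
move=> oA C1f.
have -> : f = fun x => \sum_i \sum_j f x i j *: delta_mx i j.
  by apply/funext => x; exact: matrix_sum_delta.
apply: (@C1_on_sum 'M[R]_(m, n)) => // i.
apply: (@C1_on_sum 'M[R]_(m, n)) => // j.
exact: (@C1_on_scalel 'M[R]_(m, n)).
Qed.

Lemma C1_on_mulmx A m n p (f : V -> 'M[R]_(m, n)) (g : V -> 'M[R]_(n, p)) :
  open A -> C1_on A f -> C1_on A g -> C1_on A (fun x => f x *m g x).
Proof.
move=> oA C1f C1g; apply: (C1_on_mx oA) => i j; under eq_fun do rewrite mxE.
apply: (@C1_on_sum R _ _ _ _ oA) => k.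
exact: (C1_onM oA (C1_on_coord i k oA C1f) (C1_on_coord k j oA C1g)).
Qed.

Lemma C1_on_mulmxl A m n p (B : 'M[R]_(m, n)) (f : V -> 'M[R]_(n, p)) :
  open A -> C1_on A f -> C1_on A (fun x => B *m f x).
Proof.
by move=> oA C1f; apply: (C1_on_mulmx oA _ C1f); exact: C1_on_cst.
Qed.

Lemma C1_on_mulmxr A m n p (f : V -> 'M[R]_(m, n)) (B : 'M[R]_(n, p)) :
  open A -> C1_on A f -> C1_on A (fun x => f x *m B).
Proof.
by move=> oA C1f; apply: (C1_on_mulmx oA C1f); exact: C1_on_cst.
Qed.

Lemma C1_on_addmx A m n (f g : V -> 'M[R]_(m, n)) : open A ->
  C1_on A f -> C1_on A g -> C1_on A (fun x => f x + g x).
Proof.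
by move=> oA C1f C1g; exact: (@C1_onD 'M[R]_(m, n) _ _ _ oA C1f C1g).
Qed.

Lemma C1_on_scalemx A m n (a : V -> R) (f : V -> 'M[R]_(m, n)) :
  open A -> C1_on A a -> C1_on A f -> C1_on A (fun x => a x *: f x).
Proof.
move=> oA C1a C1f; apply: (C1_on_mx oA) => i j; under eq_fun do rewrite mxE.
exact: (C1_onM oA C1a (C1_on_coord i j oA C1f)).
Qed.

Lemma C1_on_trmx A m n (f : V -> 'M[R]_(m, n)) :
  open A -> C1_on A f -> C1_on A (fun x => (f x)^T).
Proof.
move=> oA C1f; apply: (C1_on_mx oA) => i j; under eq_fun do rewrite mxE.
exact: C1_on_coord.
Qed.

Lemma C1_on_trace A n (f : V -> 'M[R]_n) :
  open A -> C1_on A f -> C1_on A (fun x => \tr (f x)).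
Proof. by move=> oA C1f; apply: (@C1_on_sum R _ _ _ _ oA) => i; exact: C1_on_coord. Qed.

Lemma C1_on_det A n (f : V -> 'M[R]_n) :
  open A -> C1_on A f -> C1_on A (fun x => \det (f x)).
Proof.
move=> oA C1f; apply: (@C1_on_sum R _ _ _ _ oA) => s.
apply: (C1_onMl _ oA).
apply: (@C1_on_prod A _ _ (fun i x => f x i (perm.fun_of_perm s i)) oA) => i.
exact: C1_on_coord.
Qed.

Lemma C1_on_adj A n (f : V -> 'M[R]_n) :
  open A -> C1_on A f -> C1_on A (fun x => \adj (f x)).
Proof.
move=> oA C1f; apply: (C1_on_mx oA) => i j; under eq_fun do rewrite mxE.
apply: (C1_onMl _ oA).
apply: (C1_on_det oA); apply: (C1_on_mx oA) => k l.
by under eq_fun do rewrite !mxE; exact: C1_on_coord.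
Qed.

Lemma C1_on_invmx A n (f : V -> 'M[R]_n) : open A -> C1_on A f ->
  (forall x, A x -> \det (f x) != 0) -> C1_on A (fun x => invmx (f x)).
Proof.
move=> oA C1f f0.
have C1inv : C1_on A (fun x => (\det (f x))^-1 *: \adj (f x)).
  apply: (C1_on_scalemx oA _ (C1_on_adj oA C1f)).
  exact: (C1_on_inv oA (C1_on_det oA C1f)).
apply: (C1_on_eq oA _ C1inv) => x /f0 fx0.
by rewrite /invmx unitmxE unitfE fx0.
Qed.

End C1.

(** The chain rule in coordinates of the intermediate matrix space. *)
Lemma derive_comp_mx (R : realType) (V : normedModType R) m n
    (f : V -> 'M[R]_(m, n)) (h : 'M[R]_(m, n) -> R) x v :
  differentiable f x -> differentiable h (f x) ->
  'D_v (fun y => h (f y)) x =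
    \sum_a \sum_i 'D_v f x a i * 'D_(delta_mx a i) h (f x).
Proof.
move=> df dh; have dc := differentiable_comp df dh.
rewrite -[fun y => _]/(h \o f) (deriveE _ dc) diff_comp//= -(deriveE v df).
have -> : 'd h (f x) ('D_v f x) =
    'd h (f x) (\sum_a \sum_i 'D_v f x a i *: delta_mx a i).
  by rewrite -matrix_sum_delta.
rewrite linear_sum; apply: eq_bigr => a _.
rewrite linear_sum; apply: eq_bigr => i _.
by rewrite linearZ /= -deriveE.
Qed.

Lemma C1_on_comp_mx (R : realType) (V : normedModType R) m n A
    (B : set 'M[R]_(m, n)) (f : V -> 'M[R]_(m, n)) (h : 'M[R]_(m, n) -> R) :
  open A -> (forall x, A x -> B (f x)) -> C1_on A f -> C1_on B h ->
  C1_on A (fun x => h (f x)).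
Proof.
move=> oA fB C1f C1h.
apply: (@C1_onI _ _ _ _ _ (fun v x =>
  \sum_a \sum_i 'D_v f x a i * 'D_(delta_mx a i) h (f x))) => // [x|x v|x v] Ax;
  have [df cf] := C1f x Ax; have [dh ch] := C1h _ (fB _ Ax).
- exact: (differentiable_comp df dh).
- exact: derive_comp_mx.
- have addc : continuous (fun z : R * R => z.1 + z.2) by exact: add_continuous.
  apply: (cvg_big (P := xpredT) addc) => a _.
  apply: (cvg_big (P := xpredT) addc) => i _.
  have cfv := continuous_comp (cf v) (@coord_continuous _ _ _ a i _).
  exact: (cvgM cfv (continuous_comp (differentiable_continuous df) (ch _))).
Qed.

(** * Orthogonality and Gram matrices over the reals *)

Lemma mulmx_tr_diag_ge0 (R : realType) m n (A : 'M[R]_(m, n)) i :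
  0 <= (A *m A^T) i i.
Proof. by rewrite mxE; apply: sumr_ge0 => j _; rewrite mxE -expr2 sqr_ge0. Qed.

Lemma mulmx_tr_eq0 (R : realType) m n (A : 'M[R]_(m, n)) :
  (forall i, (A *m A^T) i i = 0) -> A = 0.
Proof.
move=> A0; apply/matrixP => i j; move: (A0 i); rewrite !mxE => /eqP.
rewrite psumr_eq0 => [/allP/(_ j)|k _]; last by rewrite mxE -expr2 sqr_ge0.
by rewrite mem_index_enum mxE mulf_eq0 orbb => /(_ isT)/eqP.
Qed.

Lemma full_col_rank_inj (R : realType) N n (P : 'M[R]_(N, n)) m (v : 'M[R]_(m, n)) :
  \rank P = n -> v *m P^T = 0 -> v = 0.
Proof.
move=> rP vP; have rfP : row_free P^T by rewrite /row_free mxrank_tr rP.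
by apply: (row_free_inj rfP); rewrite mul0mx.
Qed.

(** The segment from the identity to the Gram matrix consists of positive
    definite, hence invertible, matrices.  Along it the determinant is a
    polynomial without roots, equal to [1] at the start, so it stays positive. *)
Lemma det_gram_gt0 (R : realType) N n (P : 'M[R]_(N, n)) :
  \rank P = n -> 0 < \det (P^T *m P).
Proof.
move=> rP; set g := P^T *m P; rewrite ltNge; apply/negP => g_le0.
pose M := (1 - 'X)%:M + 'X *: map_mx polyC g : 'M[{poly R}]_n.
have MtE t : (\det M).[t] = \det ((1 - t)%:M + t *: g).
  rewrite -horner_evalE -det_map_mx; congr (\det _); apply/matrixP => i j.
  rewrite !mxE rmorphD rmorphM rmorphMn rmorphB /= /horner_eval.
  by rewrite !hornerE.
have [t t01 /rootP] : exists2 t, 0 <= t <= 1 & root (- \det M) t.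
  apply: poly_ivt; rewrite ?ler01// !hornerN !MtE.
  rewrite subr0 scale0r addr0 subrr scale1r det_scalar expr1n oppr_le0 ler01/=.
  by rewrite raddf0 add0r oppr_ge0.
rewrite hornerN MtE => /eqP; rewrite oppr_eq0 => /det0P[v v_neq0 vM].
have := congr1 (fun A => (A *m v^T) 0 0) vM.
rewrite mul0mx mulmxDr mul_mx_scalar -scalemxAr mulmxDl -!scalemxAl.
have -> : v *m g *m v^T = (v *m P^T) *m (v *m P^T)^T.
  by rewrite trmx_mul trmxK !mulmxA.
rewrite [LHS]mxE [X in X + _]mxE [X in _ + X]mxE [RHS]mxE.
have := mulmx_tr_diag_ge0 v 0; have := mulmx_tr_diag_ge0 (v *m P^T) 0.
set a := (_ *m _^T) 0 0; set b := (v *m _) 0 0 => a0 b0 E.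
have {}v_neq0 : b != 0.
  apply: contra_neq v_neq0 => b_eq0; apply: mulmx_tr_eq0 => i.
  by rewrite (ord1 i).
have {}v_neq0a : a != 0.
  apply: contra_neq v_neq0 => a_eq0; rewrite /b.
  rewrite (full_col_rank_inj rP (v := v)) ?mul0mx ?mxE//.
  by apply: mulmx_tr_eq0 => i; rewrite (ord1 i).
have {}a0 : 0 < a by rewrite lt_neqAle eq_sym v_neq0a.
have {}b0 : 0 < b by rewrite lt_neqAle eq_sym v_neq0.
have convex_gt0 (s c d : R) : 0 <= s <= 1 -> 0 < c -> 0 < d ->
    (1 - s) * d + s * c <> 0 by move=> s01 c0 d0; nra.
exact: convex_gt0 E.
Qed.

Lemma kermx_ortho (R : realType) N n (A : 'M[R]_(N, n)) m (v : 'M[R]_(m, N)) :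
  (v <= kermx A)%MS -> (v <= kermx (kermx A)^T)%MS -> v = 0.
Proof.
move=> /submxP[w vE] /sub_kermxP vV; apply: mulmx_tr_eq0 => i.
by rewrite {2}vE trmx_mul mulmxA vV mul0mx mxE.
Qed.

Lemma kermx_ortho_cap (R : realType) N n (A : 'M[R]_(N, n)) :
  (kermx A :&: kermx (kermx A)^T = 0)%MS.
Proof.
apply/eqP; rewrite -submx0; apply/row_subP => i.
have := row_sub i (kermx A :&: kermx (kermx A)^T)%MS.
by rewrite sub_capmx => /andP[/kermx_ortho H /H ->]; rewrite sub0mx.
Qed.

Lemma kermx_ortho_full (R : realType) N n (A : 'M[R]_(N, n)) m
    (v : 'M[R]_(m, N)) :
  (v <= kermx A + kermx (kermx A)^T)%MS.
Proof.
apply: submx_full; rewrite /row_full (mxrank_disjoint_sum (kermx_ortho_cap A)).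
by rewrite (mxrank_ker (kermx A)^T) mxrank_tr subnKC // rank_leq_row.
Qed.

(** [perp A] is the projection onto the null space of [A^T] along its orthogonal
    complement, so it kills exactly the vectors of that complement. *)
Lemma perp_eq0 (R : realType) N n m (A : 'M[R]_(N, n)) (d : 'M[R]_(N, m)) :
  perp A *m d = 0 <-> kermx A *m d = 0.
Proof.
rewrite /perp; set V := kermx A; set W := kermx V^T.
have WE : (d^T <= W)%MS <-> V *m d = 0.
  split => [/sub_kermxP|Vd]; last by apply/sub_kermxP; rewrite -trmx_mul Vd trmx0.
  by rewrite -trmx_mul => /(congr1 trmx); rewrite trmxK trmx0.
rewrite -WE; split=> [|dW]; last first.
  by apply: trmx_inj; rewrite trmx_mul trmxK trmx0 (proj_mx_0 (kermx_ortho_cap A)).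
move=> /(congr1 trmx); rewrite trmx_mul trmxK trmx0 => dV.
have := proj_mx_compl_sub (kermx_ortho_full A d^T).
by rewrite dV subr0.
Qed.

(** Both terms of the sum vanish because they lie in complementary orthogonal
    subspaces: the column space of [A] and the null space of [A^T]. *)
Lemma range_perp_sum_eq0 (R : realType) N n m (A : 'M[R]_(N, n)) (c : 'M[R]_(n, m))
  (d : 'M[R]_(N, m)) :
  A *m c + perp A *m d = 0 <-> A *m c = 0 /\ kermx A *m d = 0.
Proof.
rewrite -perp_eq0; split=> [sum0|[-> ->]]; last exact: addr0.
suff Ac0 : A *m c = 0 by split=> //; move: sum0; rewrite Ac0 add0r.
apply: trmx_inj; rewrite trmx0; apply: (@kermx_ortho _ _ _ A).
  move/eqP: sum0; rewrite addr_eq0 => /eqP ->; rewrite raddfN /= trmx_mul trmxK.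
  by rewrite -mulNmx proj_mx_sub.
by apply/sub_kermxP; rewrite -trmx_mul mulmxA mulmx_ker mul0mx trmx0.
Qed.

(** * Extending null vectors of a constant rank matrix field *)

(** Choose constant [E] and [F] with [E A(x) F] the identity matrix of size the
    rank.  Then [M = E A F] stays invertible near [x], and because the rank of
    [A] does not jump up, the columns of [A F] still span the columns of [A].
    Subtracting from [w] the combination [w A F M^-1 E] kills [A F], hence [A],
    and changes nothing at [x], where [w A] is already zero. *)
Lemma kernel_section (R : realType) (V : normedModType R) N n k
    (A : V -> 'M[R]_(N, n)) (Om : set V) x (w : 'rV[R]_N) :
  open Om -> C1_on Om A -> (forall y, Om y -> \rank (A y) = k) ->
  Om x -> w *m A x = 0 ->
  exists D nu, [/\ open D, D `<=` Om, D x, C1_on D nu &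
    (forall y, D y -> nu y *m A y = 0) /\ nu x = w].
Proof.
move=> oOm C1A rkA Omx wAx.
pose E := pinvmx (col_base (A x)); pose F := pinvmx (row_base (A x)).
pose M y := E *m A y *m F.
have Mx : M x = 1%:M.
  transitivity (E *m (col_base (A x) *m row_base (A x)) *m F).
    by rewrite mulmx_base.
  have EC : E *m col_base (A x) = 1%:M := mulVpmx (col_base_full _).
  have FR : row_base (A x) *m F = 1%:M := mulmxVp (row_base_free _).
  by rewrite mulmxA EC mul1mx FR.
(* Only the identity E *m A x *m F = 1 matters from here on. *)
clearbody E F.
have C1AF : C1_on Om (fun y => A y *m F).
  exact: (C1_on_mulmxr _ oOm C1A).
have C1M : C1_on Om M.
  have -> : M = fun y => E *m (A y *m F).
    by apply/funext => y; rewrite /M mulmxA.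
  exact: (C1_on_mulmxl _ oOm C1AF).
have C1det := C1_on_det oOm C1M.
pose D := interior [set y | Om y /\ 0 < \det (M y)].
have DOm : D `<=` Om by move=> y /interior_subset[].
have Ddet y : D y -> \det (M y) != 0.
  by move=> /interior_subset[_ /lt0r_neq0].
have oD : open D by exact: open_interior.
pose nu y := w - w *m (A y *m F *m (invmx (M y) *m E)).
exists D, nu; split=> //.
- have gt0x : 0 < \det (M x) by rewrite Mx det1.
  have := C1_on_continuous C1det Omx.
  move=> /(@cvgr_gt _ _ _ _ _ _)/(_ _ gt0x) detM.
  by apply: filterS2 (open_nbhs_nbhs (conj oOm Omx)) detM => y; split.
- have C1inv : C1_on D (fun y => invmx (M y)).
    by apply: (C1_on_invmx oD) => //; exact: C1_on_sub C1M.
  have C1p : C1_on D (fun y => A y *m F *m (invmx (M y) *m E)).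
    apply: (C1_on_mulmx oD); first exact: C1_on_sub C1AF.
    exact: (C1_on_mulmxr _ oD C1inv).
  have -> : nu = fun y => w + (- w) *m (A y *m F *m (invmx (M y) *m E)).
    by apply/funext => y; rewrite /nu mulNmx.
  apply: (C1_on_addmx oD _ (C1_on_mulmxl _ oD C1p)).
  exact: C1_on_cst.
- split=> [y Dy|]; last first.
    by rewrite /nu !mulmxA wAx !mul0mx subr0.
  have Mu : M y \in unitmx by rewrite unitmxE unitfE Ddet.
  have nuAF : nu y *m (A y *m F) = 0.
    rewrite /nu mulmxBl -!mulmxA [E *m _]mulmxA -/(M y).
    by rewrite mulVmx// mulmx1 subrr.
  have /submxP[X XE] : ((A y)^T <= (A y *m F)^T)%MS.
    have sub : ((A y *m F)^T <= (A y)^T)%MS by rewrite trmx_mul submxMl.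
    have := mxrank_leqif_sup sub; rewrite !mxrank_tr => -[_ <-].
    have rkM : (\rank (M y) <= \rank (A y *m F))%N.
      by rewrite /M -mulmxA mxrankM_maxr.
    rewrite eqn_leq mxrankM_maxl (rkA _ (DOm _ Dy)) -(rkA _ Omx).
    by apply: leq_trans rkM; rewrite mxrank_unit.
  by rewrite -[A y]trmxK XE trmx_mul trmxK mulmxA nuAF mul0mx.
Qed.

(** * The derivative of the dilation function *)

Lemma derive_sumE (R : realType) (V : normedModType R) n (F : 'I_n -> V -> R)
    x v : (forall i, differentiable (F i) x) ->
  'D_v (fun y => \sum_i F i y) x = \sum_i 'D_v (F i) x.
Proof.
move=> dF; rewrite -derive_sum => [|i]; last exact: diff_derivable.
by congr ('D_v _ x); apply/funext => y; rewrite fct_sumE.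
Qed.

(** Moving along one entry leaves the cofactors of its row unchanged, so the
    determinant is affine in that entry with the cofactor as slope. *)
Lemma derive_det_delta (R : realType) n (A : 'M[R]_n) i j :
  'D_(delta_mx i j) (fun B : 'M[R]_n => \det B) A = cofactor A i j.
Proof.
have detE (h : R) :
    \det (h *: delta_mx i j + A) = \det A + h * cofactor A i j.
  have cofE l : cofactor (h *: delta_mx i j + A) i l = cofactor A i l.
    rewrite /cofactor; congr (_ * \det _); apply/matrixP => k m.
    by rewrite !mxE eq_sym (negPf (neq_lift i k)) mulr0 add0r.
  rewrite (expand_det_row _ i) [in RHS](expand_det_row _ i).
  under eq_bigr do rewrite cofE !mxE eqxx/= mulrDl.
  rewrite big_split /= addrC; congr (_ + _).
  rewrite (bigD1 j)//= eqxx mulr1 big1 ?addr0// => l /negPf ->.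
  by rewrite mulr0 mul0r.
rewrite /derive; apply: cvg_lim => //.
have qE : {near (0 : R)^', cst (cofactor A i j) =1 (fun h =>
    h^-1 *: (\det (h *: delta_mx i j + A) - \det A))}.
  near=> h; rewrite /= detE addrAC subrr add0r /GRing.scale/= mulKf//.
  by near: h; exact: nbhs_dnbhs_neq.
exact: cvg_trans (near_eq_cvg qE) (cvg_cst _).
Unshelve. all: by end_near. Qed.

Lemma C1_on_id (R : realType) N n : C1_on [set: 'M[R]_(N, n)] id.
Proof.
move=> P _; split=> [|H]; first by [].
have -> : 'D_H (@id 'M[R]_(N, n)) = cst H.
  by apply/funext => Q; rewrite derive_id.
exact: cst_continuous.
Qed.

Section dilation.
Variables (R : realType) (N n : nat).
Implicit Types (P Q : 'M[R]_(N, n)).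

Definition gram P : 'M[R]_n := P^T *m P.

Lemma gram_tr P : (gram P)^T = gram P.
Proof. by rewrite /gram trmx_mul trmxK. Qed.

Definition normalized_gram P : 'M[R]_n :=
  \det (gram P) `^ (- n%:R^-1) *: gram P.

Lemma normalized_gram_tr P : (normalized_gram P)^T = normalized_gram P.
Proof. by rewrite /normalized_gram linearZ /= gram_tr. Qed.

Lemma C1_on_gram : C1_on [set: 'M[R]_(N, n)] gram.
Proof.
have C1id := @C1_on_id R N n.
exact: (C1_on_mulmx openT (C1_on_trmx openT C1id) C1id).
Qed.

Lemma C1_on_det_gram : C1_on setT (fun P => \det (gram P)).
Proof. exact: (C1_on_det openT C1_on_gram). Qed.

Definition immersive : set 'M[R]_(N, n) := [set P | 0 < \det (gram P)].

Lemma open_immersive : open immersive.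
Proof.
rewrite openE => P detP; rewrite /interior.
by apply: (@cvgr_gt _ _ _ _ _ _ (C1_on_continuous C1_on_det_gram I)).
Qed.

Lemma C1_on_powR_det p : C1_on immersive (fun P => \det (gram P) `^ p).
Proof.
apply: (C1_on_powR _ open_immersive) => //.
exact: C1_on_sub C1_on_det_gram.
Qed.

Lemma dilationE P : K P = \tr (gram P) * \det (gram P) `^ (- n%:R^-1).
Proof.
rewrite /K /frob sqr_sqrtr// /mxtrace; apply: sumr_ge0 => i _.
by have := mulmx_tr_diag_ge0 P^T i; rewrite trmxK.
Qed.

Lemma C1_on_K : C1_on immersive (@K R N n).
Proof.
have -> : @K R N n = fun P => \tr (gram P) * \det (gram P) `^ (- n%:R^-1).
  by apply/funext => P; exact: dilationE.
have C1tr := C1_on_trace openT C1_on_gram.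
apply: (C1_onM open_immersive); first exact: C1_on_sub C1tr.
exact: C1_on_powR_det.
Qed.

Lemma derive_gram P H j k :
  'D_H (fun Q => gram Q j k) P = \sum_b (P b j * H b k + P b k * H b j).
Proof.
have dcoord b l : differentiable (fun Q => Q b l) P by exact: differentiable_coord.
have DcoordE b l : 'D_H (fun Q : 'M[R]_(N, n) => Q b l) P = H b l.
  by rewrite (derive_coord (f := id))// derive_id.
have -> : (fun Q => gram Q j k) = fun Q => \sum_b Q b j * Q b k.
  apply/funext => Q; rewrite mxE; apply: eq_bigr => b _; by rewrite mxE.
rewrite derive_sumE => [|b]; last exact: differentiableM.
apply: eq_bigr => b _.
have := deriveM (diff_derivable (v := H) (dcoord b j))
                (diff_derivable (dcoord b k)).
by rewrite !DcoordE => ->.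
Qed.

Lemma derive_gram_delta P a i j k :
  'D_(delta_mx a i) (fun Q => gram Q j k) P =
  P a j *+ (k == i) + P a k *+ (j == i).
Proof.
rewrite derive_gram (bigD1 a)//= !mxE eqxx/= big1 => [|b /negPf ba]; last first.
  by rewrite !mxE ba !mulr0 addr0.
by rewrite addr0 !mulr_natr.
Qed.

Lemma derive_tr_gram P a i :
  'D_(delta_mx a i) (fun Q => \tr (gram Q)) P = P a i *+ 2.
Proof.
rewrite /mxtrace derive_sumE => [|j]; last first.
  by have [] := C1_on_coord j j openT C1_on_gram (x := P) I.
under eq_bigr do rewrite derive_gram_delta.
rewrite (bigD1 i)//= eqxx big1 ?addr0 -?mulr2n// => j /negPf ->.
by rewrite !mulr0n addr0.
Qed.

(** Jacobi's formula combined with the chain rule.  The two terms of the product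
    rule for [P^T P] contribute equally because the Gram matrix is symmetric. *)
Lemma derive_det_gram P a i :
  'D_(delta_mx a i) (fun Q => \det (gram Q)) P = (P *m \adj (gram P)) a i *+ 2.
Proof.
have [dg _] := C1_on_gram (x := P) I.
have [ddet _] := C1_on_det openT (@C1_on_id R n n) (x := gram P) I.
rewrite (derive_comp_mx _ dg ddet).
under eq_bigr => j _ do under eq_bigr => k _ do
  rewrite derive_det_delta -(derive_coord _ j k dg) derive_gram_delta mulrDl.
under eq_bigr do rewrite big_split /=.
rewrite big_split /= mulr2n; congr (_ + _).
  rewrite mxE; apply: eq_bigr => j _.
  rewrite (bigD1 i)//= eqxx big1 => [|k /negPf ->].
    by rewrite addr0 mulr1n -{2}gram_tr -trmx_adj !mxE.
  by rewrite mulr0n mul0r.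
rewrite exchange_big mxE /=; apply: eq_bigr => k _.
rewrite (bigD1 i)//= eqxx big1 => [|j /negPf ->].
  by rewrite addr0 mulr1n !mxE.
by rewrite mulr0n mul0r.
Qed.

Lemma AhlforsZ c (A : 'M[R]_n) : Ahlfors (c *: A) = c *: Ahlfors A.
Proof.
apply/matrixP => i j; rewrite /Ahlfors mxtraceZ !mxE.
by case: eqP => _; rewrite ?mulr1n ?mulr0n; ring.
Qed.

Lemma Ahlfors_sym (A : 'M[R]_n) : A^T = A ->
  Ahlfors A = A - (n%:R^-1 * \tr A)%:M.
Proof.
move=> AT; rewrite /Ahlfors AT; congr (_ - _).
by apply/matrixP => i j; rewrite !mxE; lra.
Qed.

(** The product rule applied to [K = tr(g) det(g)^(-1/n)].  The trace part gives
    [2 P] and the determinant part [- (2/n) tr(g) P g^-1], both scaled by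
    [det(g)^(-1/n)]; this is [2 P g^-1] times the trace-free part of the
    normalized Gram matrix, which is symmetric. *)
Lemma KP_formula P : immersive P ->
  KP P = 2 *: (P *m invmx (gram P) *m Ahlfors (normalized_gram P)).
Proof.
move=> Pimm; have gu : gram P \in unitmx by rewrite unitmxE unitfE lt0r_neq0.
have dgt0 : 0 < \det (gram P) by [].
apply/matrixP => a i; rewrite mxE /normalized_gram.
rewrite AhlforsZ Ahlfors_sym ?gram_tr// -scalemxAr mulmxBr mulmxKV//.
rewrite mul_mx_scalar {1}/invmx gu -scalemxAr.
have DdetE := derive_det_gram P a i.
move: (P *m \adj (gram P)) DdetE => M DdetE; rewrite !mxE.
have [dtr _] := C1_on_trace openT C1_on_gram (x := P) I.
have [ddet _] := C1_on_det_gram (x := P) I.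
have [dpow DpowE] :=
  derive_comp1 (delta_mx a i) ddet (is_derive1_powR (- n%:R^-1) dgt0).
have -> : @K R N n = fun P => \tr (gram P) * \det (gram P) `^ (- n%:R^-1).
  by apply/funext => Q; exact: dilationE.
have := deriveM (diff_derivable (v := delta_mx a i) dtr) (diff_derivable dpow).
move=> ->; rewrite DpowE derive_tr_gram DdetE.
rewrite powRB; last by rewrite (gt_eqF dgt0) implybT.
rewrite powRr1 ?ltW// /GRing.scale/=.
rewrite [RHS]mulrC; move: dgt0 => /lt0r_neq0.
move: (\tr _) (\det _) (_ `^ _) (M a i) => t d e m d0.
by move: (n%:R^-1 : R) => q; field.
Qed.

(** [K] is twice continuously differentiable where [det(g) > 0]: the explicit
    formula for its gradient is [C^1] there. *)
Lemma C1_on_KP : C1_on immersive (@KP R N n).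
Proof.
have oI := open_immersive.
have C1g : C1_on immersive gram := C1_on_sub (@subsetT _ _) C1_on_gram.
have C1G : C1_on immersive normalized_gram := C1_on_scalemx oI (C1_on_powR_det _) C1g.
have C1S : C1_on immersive
    (fun P => normalized_gram P + (- (n%:R^-1 * \tr (normalized_gram P))) *: (1%:M : 'M[R]_n)).
  apply: (C1_on_addmx oI C1G); apply: (@C1_on_scalel _ _ 'M[R]_n _ _ _ oI).
  have -> : (fun P => - (n%:R^-1 * \tr (normalized_gram P))) =
      fun P => - n%:R^-1 * \tr (normalized_gram P).
    by apply/funext => P; rewrite mulNr.
  exact: (C1_onMl _ oI (C1_on_trace oI C1G)).
have C1inv : C1_on immersive (fun P => invmx (gram P)).
  by apply: (C1_on_invmx oI C1g) => P; exact: lt0r_neq0.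
have C1id : C1_on immersive (fun P => 2 *: P).
  apply: (C1_on_scalemx oI (C1_on_cst (2 : R))).
  exact: (C1_on_sub (@subsetT _ _) (@C1_on_id R N n)).
have C1KPf := C1_on_mulmx oI (C1_on_mulmx oI C1id C1inv) C1S.
apply: (C1_on_eq oI _ C1KPf) => P Pimm.
rewrite KP_formula// -!scalemxAl; congr (_ *: (_ *m _)).
rewrite Ahlfors_sym ?normalized_gram_tr//.
by rewrite scaleNr scale_scalar_mx mulr1.
Qed.

(** [P^T] is a left inverse of [P g^-1]; this is what makes the factor [P g^-1]
    in the formula for [KP] harmless for null vectors and for the rank. *)
Lemma tr_mul_KP P : immersive P ->
  P^T *m KP P = 2 *: Ahlfors (normalized_gram P).
Proof.
move=> Pimm; rewrite KP_formula// -scalemxAr !mulmxA mulmxV ?mul1mx//.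
by rewrite unitmxE unitfE lt0r_neq0.
Qed.

Lemma KP_mul_eq0 P m (v : 'M[R]_(n, m)) : immersive P ->
  KP P *m v = 0 <->
  Ahlfors (normalized_gram P) *m v = 0.
Proof.
move=> Pimm; split=> [KPv|Sv]; last first.
  by rewrite KP_formula// -scalemxAl -mulmxA Sv mulmx0 scaler0.
have /eqP : 2 *: (Ahlfors (normalized_gram P) *m v) = 0.
  by rewrite scalemxAl -tr_mul_KP// -mulmxA KPv mulmx0.
by rewrite scaler_eq0 pnatr_eq0 => /eqP.
Qed.

Lemma rank_KP P : immersive P -> \rank (KP P) = \rank (Ahlfors (gram P)).
Proof.
move=> Pimm; have Pimm' : 0 < \det (gram P) by [].
pose c := \det (gram P) `^ (- n%:R^-1).
have c0 : c != 0 by rewrite gt_eqF// powR_gt0.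
apply/eqP; rewrite eqn_leq; apply/andP; split.
  rewrite KP_formula// /normalized_gram AhlforsZ.
  rewrite mxrank_scale_nz ?pnatr_eq0// (leq_trans (mxrankM_maxr _ _))//.
  by rewrite mxrank_scale_nz.
have := mxrankM_maxr P^T (KP P).
by rewrite tr_mul_KP// /normalized_gram AhlforsZ !mxrank_scale_nz// pnatr_eq0.
Qed.

End dilation.

(** * The operator along an immersion *)

Section immersion.
Variables (R : realType) (n N : nat) (Omega : set 'rV[R]_n).
Variable u : 'rV[R]_n -> 'rV[R]_N.
Hypothesis openOmega : open Omega.
Hypotheses (imm_u : immersion Omega u) (C2_u : C2_on Omega u).

(** The entries of the Jacobian are partial derivatives, which makes the
    second order hypothesis on [u] available for [Du]. *)
Lemma Du_entry (w : 'rV[R]_n -> 'rV[R]_N) x b j :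
  differentiable w x -> Du w x b j = 'D_(delta_mx 0 j) w x 0 b.
Proof. by move=> dw; rewrite deriveEjacobian// -rowE /Du !mxE. Qed.

Lemma C1_on_Du : C1_on Omega (Du u).
Proof.
apply: (C1_on_mx openOmega) => b j.
have C1Dj := C1_on_coord 0 b openOmega (C2_u.2 (delta_mx 0 j)).
apply: (C1_on_eq openOmega _ C1Dj).
by move=> x /imm_u.1[du _]; rewrite Du_entry.
Qed.

Lemma Du_immersive x : Omega x -> immersive (Du u x).
Proof. by move=> /imm_u.2 rk; exact: det_gram_gt0. Qed.

Lemma C1_on_KP_Du : C1_on Omega (fun x => KP (Du u x)).
Proof.
apply: (C1_on_mx openOmega) => a i.
have C1KP := C1_on_coord a i (@open_immersive R N n) (@C1_on_KP R N n).
exact: (C1_on_comp_mx openOmega Du_immersive C1_on_Du C1KP).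
Qed.

Definition Div (A : 'rV[R]_n -> 'M[R]_(N, n)) (x : 'rV[R]_n) : 'cV[R]_N :=
  \col_a \sum_i 'D_(delta_mx 0 i) (fun y => A y a i) x.

(** [tr G] and [K(Du)] are the same function, so this is the chain rule. *)
Lemma gradient_tr_G x i : Omega x ->
  gradient (fun y => \tr (G u y)) x i 0 =
  \sum_b \sum_j KP (Du u x) b j * D2 u x i j b.
Proof.
move=> Ox; have [dDu _] := C1_on_Du Ox; have [dK _] := C1_on_K (Du_immersive Ox).
rewrite mxE; have -> : (fun y => \tr (G u y)) = fun y => K (Du u y).
  by apply/funext => y; rewrite dilationE /G mxtraceZ mulrC.
rewrite (derive_comp_mx _ dDu dK); apply: eq_bigr => b _; apply: eq_bigr => j _.
by rewrite /D2 derive_coord// mulrC /KP mxE.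
Qed.

Lemma Div_KP_Du x c : Omega x ->
  Div (fun y => KP (Du u y)) x c 0 =
  \sum_i \sum_b \sum_j KPP (Du u x) c i b j * D2 u x i j b.
Proof.
move=> Ox; have [dDu _] := C1_on_Du Ox; rewrite mxE; apply: eq_bigr => i _.
have C1KP := C1_on_coord c i (@open_immersive R N n) (@C1_on_KP R N n).
have [dKP _] := C1KP _ (Du_immersive Ox).
rewrite (derive_comp_mx (h := fun Q => KP Q c i) _ dDu dKP).
apply: eq_bigr => b _; apply: eq_bigr => j _.
by rewrite /D2 derive_coord// mulrC.
Qed.

(** Both contractions with the second derivatives of [u] are chain rules; it
    remains to exchange the sums. *)
Lemma Qinf_col x : Omega x ->
  \col_a Qinf u x a = KP (Du u x) *m gradient (fun y => \tr (G u y)) x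
    + perp (KP (Du u x)) *m Div (fun y => KP (Du u y)) x.
Proof.
move=> Ox; apply/colP => a; rewrite mxE [RHS]mxE [X in X + _]mxE.
rewrite [X in _ + X]mxE /Qinf; under [in RHS]eq_bigr do rewrite gradient_tr_G//.
under [X in _ + X]eq_bigr do rewrite Div_KP_Du// mulr_sumr.
rewrite [X in _ + X]exchange_big -big_split /=; apply: eq_bigr => i _.
under [X in _ + X]eq_bigr do rewrite mulr_sumr.
rewrite mulr_sumr [X in _ + X]exchange_big -big_split /=; apply: eq_bigr => b _.
under [X in _ + X]eq_bigr do rewrite mulr_sumr.
rewrite mulr_sumr [X in _ + X]exchange_big -big_split /=; apply: eq_bigr => j _.
rewrite mulrDl mulr_suml mulrA; congr (_ + _).
by apply: eq_bigr => c _; rewrite mulrA.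
Qed.

Lemma Qinf_eq0 x : Omega x ->
  (forall a, Qinf u x a = 0) <->
  Ahlfors (G u x) *m gradient (fun y => \tr (G u y)) x = 0 /\
  kermx (KP (Du u x)) *m Div (fun y => KP (Du u y)) x = 0.
Proof.
move=> Ox; have colE : (forall a, Qinf u x a = 0) <-> \col_a Qinf u x a = 0.
  split=> [Q0|/colP Q0 a]; first by apply/colP => a; rewrite !mxE.
  by have := Q0 a; rewrite !mxE.
rewrite colE Qinf_col// range_perp_sum_eq0 KP_mul_eq0//.
exact: Du_immersive.
Qed.

(** Differentiate the identity [nu K_P(Du) = 0] column by column, in the
    direction of the column index, and add up. *)
Lemma normal_section_Div (D : set 'rV[R]_n) nu x :
  open D -> D `<=` Omega -> normal_section u D nu -> D x ->
  nu x *m Div (fun y => KP (Du u y)) x = - (colon (Bperp nu x) (KP (Du u x)))%:M.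
Proof.
move=> oD DO [C1nu nuKP] Dx; have [dnu _] := C1nu x Dx.
have dKP a i : differentiable (fun y => KP (Du u y) a i) x.
  by have [] := C1_on_coord a i openOmega C1_on_KP_Du (DO _ Dx).
have dnua a : differentiable (fun y => nu y 0 a) x.
  by have [] := C1_on_coord 0 a oD C1nu Dx.
have D0 i : \sum_a (nu x 0 a * 'D_(delta_mx 0 i) (fun y => KP (Du u y) a i) x
    + KP (Du u x) a i * Du nu x a i) = 0.
  transitivity ('D_(delta_mx 0 i) (fun y => \sum_a nu y 0 a * KP (Du u y) a i) x).
    rewrite derive_sumE => [|a]; last exact: differentiableM.
    apply: eq_bigr => a _.
    have := deriveM (diff_derivable (v := delta_mx 0 i) (dnua a))
                    (diff_derivable (dKP a i)).
    by move=> ->; rewrite Du_entry// (derive_coord _ 0 a dnu).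
  rewrite -[RHS](derive_cst 0 x (delta_mx 0 i)); apply: near_eq_derive.
  near=> y; have Dy : D y by near: y; exact: open_nbhs_nbhs.
  by have /rowP/(_ i) := nuKP y Dy; rewrite !mxE.
apply/matrixP => k l; rewrite !ord1 !mxE eqxx mulr1n; apply/eqP.
rewrite -addr_eq0; apply/eqP.
have : \sum_i \sum_a (nu x 0 a * 'D_(delta_mx 0 i) (fun y => KP (Du u y) a i) x
    + KP (Du u x) a i * Du nu x a i) = 0.
  by apply: big1 => i _; exact: D0.
under eq_bigr do rewrite big_split /=.
rewrite big_split /= => sum0; rewrite -[RHS]sum0; congr (_ + _).
  by rewrite [RHS]exchange_big /=; apply: eq_bigr => a _; rewrite mxE mulr_sumr.
rewrite [RHS]exchange_big; apply: eq_bigr => a _; apply: eq_bigr => i _.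
exact: mulrC.
Unshelve. all: by end_near. Qed.

End immersion.

Theorem proposition6p1 (R : realType) (n N : nat) (n_gt0 : (0 < n)%N)
    (Omega : set 'rV[R]_n) (openOmega : open Omega)
    (u : 'rV[R]_n -> 'rV[R]_N)
    (imm_u : immersion Omega u) (C2_u : C2_on Omega u) :
  (forall k : nat, (k <= n)%N ->
     (Qinf_system (phase Omega u k) u <->
      tangential_system (phase Omega u k) u /\
      normal_system (phase Omega u k) u)) /\
  (Qinf_system Omega u -> tangential_system Omega u).
Proof.
split=> [k _|Q0 x Ox]; last first.
  by have [] := (Qinf_eq0 openOmega imm_u C2_u Ox).1 (Q0 x Ox).
set Ok := phase Omega u k.
have oOk : open Ok by exact: open_interior.
have OkO : Ok `<=` Omega by move=> x /interior_subset[].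
have Q0E x (Okx : Ok x) := Qinf_eq0 openOmega imm_u C2_u (OkO x Okx).
split=> [Q0|[T0 N0] x Okx].
  split=> [x Okx|D oD DOk nu secnu x Dx].
    by have [] := (Q0E x Okx).1 (Q0 x Okx).
  have [_ kerDiv] := (Q0E x (DOk x Dx)).1 (Q0 x (DOk x Dx)).
  have := normal_section_Div openOmega imm_u C2_u oD (subset_trans DOk OkO) secnu Dx.
  have /submxP[w ->] : (nu x <= kermx (KP (Du u x)))%MS.
    by apply/sub_kermxP; exact: secnu.2.
  rewrite -mulmxA kerDiv mulmx0 => /matrixP/(_ 0 0)/esym/eqP.
  by rewrite !mxE eqxx mulr1n oppr_eq0 => /eqP.
apply/Q0E => //; split; first exact: T0.
apply/row_matrixP => r; rewrite row0 row_mul.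
have C1KP := C1_on_sub OkO (C1_on_KP_Du openOmega imm_u C2_u).
have rkKP y : Ok y -> \rank (KP (Du u y)) = k.
  by move=> /interior_subset[Oy <-]; rewrite rank_KP//; exact: Du_immersive Oy.
have rKP : row r (kermx (KP (Du u x))) *m KP (Du u x) = 0.
  by rewrite -row_mul mulmx_ker row0.
(* Each null vector of K_P^T at x is the value there of a normal section. *)
have [D [nu [oD DOk Dx C1nu [nuKP <-]]]] := kernel_section oOk C1KP rkKP Okx rKP.
have secnu : normal_section u D nu by split.
rewrite (normal_section_Div openOmega imm_u C2_u oD (subset_trans DOk OkO) secnu Dx).
by rewrite (N0 D oD DOk nu secnu x Dx) raddf0 oppr0.
Qed.
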